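(* Let $n\ge1$ and $0\le k\le n$. The number of ad-nilpotent ideals in $\mathcal I^n$ with class of nilpotence $k$ is equal to $$\sum_{0=i_0<i_1<\dots<i_k<i_{k+1}=n+1}\ \prod_{j=0}^{k-1}\binom{i_{j+2}-i_j-1}{i_{j+1}-i_j}.$$
   Context: Let $\mathfrak g=sl(n+1,\mathbb C)$ with a fixed Cartan subalgebra $\mathfrak h$, positive roots $\Delta^+$, root spaces $\mathfrak g_\alpha$, and Borel subalgebra $\mathfrak b=\mathfrak h\oplus\bigoplus_{\alpha\in\Delta^+}\mathfrak g_\alpha$. $\mathcal I^n$ is the set of ad-nilpotent ideals of $\mathfrak b$, i.e. ideals of $\mathfrak b$ consisting of ad-nilpotent elements. For $\mathfrak i\in\mathcal I^n$ put $\mathfrak i^1=\mathfrak i$, $\mathfrak i^{m}=[\mathfrak i^{m-1},\mathfrak i]$. The class of nilpotence of $\mathfrak i$ is the smallest $m\ge0$ with $\mathfrak i^{m+1}=0$ (so the zero ideal has class $0$, and Abelian ideals are exactly those of class at most $1$). The empty product (case $k=0$) is $1$. The sum is over integers $i_1,\dots,i_k$. *)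

(* Defs.v *)
From HB Require Import structures.
From mathcomp Require Import all_boot all_order all_algebra.
From mathcomp Require Import all_classical reals complex.

Set Implicit Arguments.
Unset Strict Implicit.
Unset Printing Implicit Defensive.

Import GRing.Theory.
Local Open Scope ring_scope.

Section LieMatrix.
Variables (F : fieldType) (N : nat).
Implicit Types (x y : 'M[F]_N) (U V I J h b : {vspace 'M[F]_N}).

Definition lie x y : 'M[F]_N := x *m y - y *m x.

Fact lie_is_linear x : linear (lie x).
Proof.
move=> a y z; rewrite /lie mulmxDr mulmxDl -scalemxAr -scalemxAl.
by rewrite opprD addrACA -scalerBr.
Qed.
HB.instance Definition _ x :=
  GRing.isLinear.Build F 'M[F]_N 'M[F]_N _ (lie x) (lie_is_linear x).

Definition ad x : 'End('M[F]_N) := linfun (lie x).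

(* The trace is given codomain F^o so that it is a vector-space morphism. *)
Definition sl : {vspace 'M[F]_N} :=
  lker (linfun (fun x : 'M[F]_N => \tr x : F^o)).

Lemma mem_sl x : (x \in sl) = (\tr x == 0).
Proof.
have lin_tr : linear (fun x : 'M[F]_N => \tr x : F^o).
  by move=> a y z; rewrite mxtraceD mxtraceZ.
pose H := GRing.isLinear.Build F 'M[F]_N F^o _ _ lin_tr.
pose T : {linear 'M[F]_N -> F^o} := HB.pack (fun x : 'M[F]_N => \tr x : F^o) H.
by rewrite memv_ker (lfunE T).
Qed.

(* The span of all brackets [u, v]; see memv_liev for independence of bases. *)
Definition liev U V : {vspace 'M[F]_N} :=
  <<[seq lie u v | u <- vbasis U, v <- vbasis V]>>%VS.

Lemma lieNC x y : lie x y = - lie y x.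
Proof. by rewrite /lie opprB. Qed.

Lemma memv_liev U V x y : x \in U -> y \in V -> lie x y \in liev U V.
Proof.
move=> /coord_vbasis-> /coord_vbasis->.
rewrite linear_sum; apply: memv_suml => j _ /=.
rewrite linearZ memvZ //= lieNC memvN linear_sum; apply: memv_suml => i _ /=.
rewrite linearZ memvZ //= lieNC memvN.
by apply/memv_span/allpairsP; exists ((vbasis U)`_i, (vbasis V)`_j);
  split; rewrite ?mem_nth ?size_tuple.
Qed.

(* lie_powS I m is the power I^(m+1), where I^1 = I and I^m = [I^(m-1), I]. *)
Definition lie_powS I (m : nat) : {vspace 'M[F]_N} :=
  iter m (fun J => liev J I) I.

Definition nilpotence_class I (m : nat) : Prop :=
  lie_powS I m = 0%VS /\ forall m', lie_powS I m' = 0%VS -> (m <= m')%N.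

Definition ad_nilpotent x : Prop :=
  exists m : nat, {in sl, forall y, iter m (lie x) y = 0}.

Definition ad_diagonalizable x : Prop :=
  exists e : seq 'M[F]_N, basis_of sl e /\
    {in e, forall y, exists a : F, lie x y = a *: y}.

(* The usual definition for semisimple Lie algebras: maximal abelian, with
   ad-semisimple elements. *)
Definition cartan_subalgebra h : Prop :=
  [/\ (h <= sl)%VS,
      {in h &, forall x y, lie x y = 0},
      {in sl, forall x, {in h, forall H, lie H x = 0} -> x \in h} &
      {in h, forall H, ad_diagonalizable H}].

Definition hdual h := 'Hom(subvs_of h, F^o).

Definition root_space h (a : hdual h) : {vspace 'M[F]_N} :=
  (sl :&: \bigcap_(H <- vbasis {:subvs_of h}) passmx.leigenspace (ad (vsval H)) (a H))%VS.

Lemma root_spaceP h (a : hdual h) x :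
  reflect (x \in sl /\ forall H : subvs_of h, lie (vsval H) x = a H *: x)
          (x \in root_space a).
Proof.
have E (H : subvs_of h) : (x \in passmx.leigenspace (ad (vsval H)) (a H)) =
    (lie (vsval H) x == a H *: x).
  by rewrite memv_ker add_lfunE opp_lfunE scale_lfunE id_lfunE lfunE subr_eq0.
rewrite memv_cap; apply: (iffP andP) => -[slx ax]; split=> //; last first.
  rewrite big_seq; elim/big_rec: _ => [|H U _ xU]; first exact: memvf.
  by rewrite memv_cap E ax eqxx.
move=> H; rewrite (coord_vbasis (memvf H)) !linear_sum /= lieNC.
rewrite linear_sum scaler_suml -sumrN; apply: eq_bigr => i _ /=.
set c := coord _ _ _; set B := (vbasis _)`_i.
have -> : lie x (vsval (c *: B)) = c *: lie x (vsval B) by rewrite !linearZ.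
have -> : a (c *: B) = c * a B by rewrite linearZ.
rewrite -scalerN -lieNC -scalerA; congr (_ *: _); apply/eqP.
rewrite -E; apply: (subvP _) ax.
have: B \in tval (vbasis {:subvs_of h}) by rewrite mem_nth ?size_tuple.
elim: (tval _) => [|H' s IHs]; rewrite ?in_nil // in_cons big_cons.
by case/predU1P=> [<-|/IHs]; [apply: capvSl | apply: subv_trans; apply: capvSr].
Qed.

Definition is_root h (a : hdual h) : Prop := a != 0 /\ root_space a != 0%VS.

(* The positive system is given as an enumeration of its (finitely many)
   elements. *)
Definition positive_system h (Dp : seq (hdual h)) : Prop :=
  [/\ {in Dp, forall a, is_root a},
      forall a, is_root a -> (a \in Dp) (+) (- a \in Dp) &
      {in Dp &, forall a c : hdual h, is_root (a + c) -> a + c \in Dp}].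

Definition borel h (Dp : seq (hdual h)) : {vspace 'M[F]_N} :=
  (h + \sum_(a <- Dp) root_space a)%VS.

Definition ad_nilpotent_ideal b I : Prop :=
  [/\ (I <= b)%VS,
      {in b & I, forall x y, lie x y \in I} &
      {in I, forall x, ad_nilpotent x}].

End LieMatrix.

Arguments sl : clear implicits.

(* The summation index t = (i_1, ..., i_k) is completed to the sequence
   (i_0, ..., i_(k+1)) = (0, i_1, ..., i_k, n+1); bounding its entries by n+1 is
   harmless, since they lie strictly between 0 and n+1. *)
Definition chain (n k : nat) (t : k.-tuple 'I_n.+2) : seq nat :=
  0%N :: rcons [seq val i | i <- t] n.+1.

Definition class_count (n k : nat) : nat :=
  (\sum_(t : k.-tuple 'I_n.+2 | sorted ltn (chain t))
     let i := nth 0 (chain t) in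
     \prod_(j < k) 'C(i j.+2 - i j - 1, i j.+1 - i j))%N.

(* Main.v *)
Require Import Defs.
From mathcomp Require Import all_boot all_order all_algebra.
From mathcomp Require Import all_classical reals complex.
From mathcomp Require Import perm zify ring.
From HB Require Import structures.

(* Simultaneous diagonalisation of h gives a basis in which the roots are the
   differences of diagonal entries; Dp is then a total order on the indices, so
   after reordering the borel subalgebra is upper triangular.  An ad-nilpotent
   ideal is spanned by the matrix units E_ij with i < g (j + 1), where
   g : {0, ..., n+1} -> {0, ..., n+1} is nondecreasing, g 0 = 0 and g m < m for
   m > 0.  Its m-th power is the span attached in the same way to the m-th iterate
   of g, so its class is k exactly when n+1 > g (n+1) > ... > g^(k+1) (n+1) = 0;
   read backwards, this is the chain i_0 < ... < i_(k+1).  Given the chain, g is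
   determined by its values strictly between i_(j+1) and i_(j+2), which form a
   nondecreasing sequence with values in [i_j, i_(j+1)]: these are counted by the
   binomial coefficients of the product. *)
Set Implicit Arguments.
Unset Strict Implicit.
Unset Printing Implicit Defensive.

(** * Nondecreasing functions with a prescribed chain of iterates *)

(** Entries are stored as offsets from [a], which reduces the count to [card_sorted_tuples]. *)
Definition nondec_seqs m a b : seq (seq nat) :=
  [seq [seq (a + val i)%N | i : 'I_(b - a).+1 <- tval t]
     | t : m.-tuple _ <- enum [set t : m.-tuple 'I_(b - a).+1 | sorted leq [seq val i | i <- t]]].

Lemma path_leq_rcons a b s : a <= b ->
  path leq a (rcons s b) = sorted leq s && all (fun x => a <= x <= b) s.
Proof.
move=> ab; rewrite path_sortedE; last exact: leq_trans.
rewrite !sorted_pairwise; try exact: leq_trans.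
rewrite pairwise_rcons all_rcons ab /=.
rewrite -[X in _ = _ && X]/(all (predI (leq a) (fun x => x <= b)) s) all_predI.
by case: (all (leq a)); case: pairwise; case: all.
Qed.

(** Both bounds are expressed by one path from [a] to [b], ready to be spliced into a longer
    nondecreasing list. *)
Lemma mem_nondec_seqs m a b (w : seq nat) : a <= b ->
  (w \in nondec_seqs m a b) = (size w == m) && path leq a (rcons w b).
Proof.
move=> ab; rewrite path_leq_rcons //; apply/mapP/and3P => [[t]|[/eqP wm wS wab]].
  rewrite mem_enum inE => tS ->; split; rewrite ?size_map ?size_tuple //.
    move: tS; rewrite !sorted_map.
    by apply: sub_sorted => i j /=; rewrite leq_add2l.
  by apply/allP=> _ /mapP[i _ ->] /=; have := ltn_ord i; lia.
have sz : size [seq inord (x - a) : 'I_(b - a).+1 | x <- w] == m.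
  by rewrite size_map wm.
have wK : [seq val (inord (x - a) : 'I_(b - a).+1) | x <- w] = [seq x - a | x <- w].
  by apply/eq_in_map => x /(allP wab) xab /=; rewrite inordK //; lia.
exists (Tuple sz) => /=.
  rewrite mem_enum inE /= -map_comp /comp wK sorted_map.
  by apply: sub_sorted wS => x y /=; lia.
rewrite -map_comp -[LHS]map_id; apply/eq_in_map => x /(allP wab) xab /=.
by rewrite inordK; lia.
Qed.

Lemma nondec_seqs_uniq m a b : uniq (nondec_seqs m a b).
Proof.
rewrite map_inj_uniq ?enum_uniq // => s t st; apply/val_inj.
by apply: inj_map st => i j /addnI/val_inj.
Qed.

(** For a = i_j, b = i_(j+1) and m = i_(j+2) - i_(j+1) - 1 this is the j-th factor of the
    product. *)
Lemma size_nondec_seqs m a b : size (nondec_seqs m a b) = 'C(m + (b - a), b - a).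
Proof.
rewrite size_map -cardE card_sorted_tuples -[in RHS]bin_sub ?leq_addl //.
by rewrite addnK.
Qed.

(* All extensions of the list [p] of values of g at 1, ..., size p to a
   nondecreasing g defined up to the last element of [c], such that g maps the
   head of [c] to size p and every other element of [c] to its predecessor. *)
Fixpoint extensions (p c : seq nat) : seq (seq nat) :=
  if c is x :: c' then
    [seq v | w <- nondec_seqs (x - size p).-1 (last 0 p) (size p),
             v <- extensions (p ++ rcons w (size p)) c']
  else [:: p].

(* The function with list of values [v] at 1, ..., size v; it is 0 elsewhere. *)
Definition pval (v : seq nat) m := nth 0 (0 :: v) m.

Lemma path_ltn_last x c : path ltn x c -> x <= last x c.
Proof. by elim: c x => //= y c IHc x /andP[xy /IHc]; lia. Qed.

Lemma pval_size_cat p x u : pval (rcons p x ++ u) (size p).+1 = x.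
Proof. by rewrite /pval /= nth_cat size_rcons leqnn nth_rcons ltnn eqxx. Qed.

(** Induction on [c], whose head is [x]: the values strictly between [size p] and [x] form a block
    [w] with entries between g (size p) and g x = [size p], and then the value at [x] is forced. *)
Lemma mem_extensions p c (v : seq nat) :
    path ltn (size p) c -> path leq 0 p -> last 0 p <= size p ->
  (v \in extensions p c) =
  [&& path leq 0 v, prefix p v, size v == last (size p) c &
      path (fun x y => pval v y == x) (size p) c].
Proof.
elim: c p => [|x c IHc] p /=.
  move=> _ pS _; rewrite inE andbT; apply/eqP/and3P => [->|[_ + /eqP sz]].
    by rewrite pS prefix_refl.
  by rewrite prefixE -sz take_size => /eqP.
move=> /andP[px xc] pS lp.
have IH (w : seq nat) : w \in nondec_seqs (x - size p).-1 (last 0 p) (size p) ->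
    (v \in extensions (p ++ rcons w (size p)) c) =
    [&& path leq 0 v, prefix (p ++ rcons w (size p)) v, size v == last x c &
      path (fun x y => pval v y == x) x c].
  rewrite mem_nondec_seqs // => /andP[/eqP wN wS].
  have sz : size (p ++ rcons w (size p)) = x by rewrite size_cat size_rcons wN; lia.
  by rewrite IHc ?sz ?cat_path ?pS // last_cat last_rcons ltnW.
apply/allpairsPdep/and4P => [[w [v' [wN vE v'E]]]|[vS pv vN /andP[vx vc]]].
  move: vE; rewrite -v'E {v' v'E} (IH w wN) => /and4P[vS /prefixP[u vE] vN vc].
  split=> //; first by rewrite vE -catA prefix_prefix.
  rewrite vc andbT vE -rcons_cat.
  move: wN; rewrite mem_nondec_seqs // => /andP[/eqP wN wS].
  have -> : x = (size (p ++ w)).+1 by rewrite size_cat wN; lia.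
  by rewrite pval_size_cat.
have [u vE] : exists u : seq nat, v = p ++ u by case/prefixP: pv => u ->; exists u.
have xv : x <= size v by rewrite (eqP vN); apply: path_ltn_last.
(* The free values of [v], strictly between [size p] and [x]; the next entry of [u] is the forced
   value at [x]. *)
pose w := take (x - size p).-1 u.
have sw : size w = (x - size p).-1.
  by rewrite size_takel //; move: xv; rewrite vE size_cat; lia.
have uE : u = rcons w (size p) ++ drop (x - size p) u.
  rewrite -{1}[u](cat_take_drop (x - size p)); congr (_ ++ _).
  rewrite -[in LHS](@prednK (x - size p)) ?subn_gt0 // (take_nth 0); last first.
    by move: xv; rewrite vE size_cat; lia.
  congr rcons; rewrite -[RHS](eqP vx) vE /pval.
  have xE : x = (size p + (x - size p).-1).+1 by lia.
  by rewrite [X in _ = nth _ _ X]xE /= nth_cat ltnNge leq_addr /= addKn.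
have wN : w \in nondec_seqs (x - size p).-1 (last 0 p) (size p).
  rewrite mem_nondec_seqs // sw eqxx /=.
  by move: vS; rewrite vE uE !cat_path => /and3P[].
exists w, v; split=> //; rewrite IH // vS vN vc !andbT /=.
by rewrite vE uE catA prefix_prefix.
Qed.

(** The block [w] can be read off from an extension [v], because [take x v] is
    [p ++ rcons w (size p)]; hence distinct blocks have no common extension. *)
Lemma extensions_uniq p c :
  path ltn (size p) c -> path leq 0 p -> last 0 p <= size p -> uniq (extensions p c).
Proof.
elim: c p => [|x c IHc] p //= /andP[px xc] pS lp.
have next (w : seq nat) : w \in nondec_seqs (x - size p).-1 (last 0 p) (size p) ->
    let q := p ++ rcons w (size p) in
    [/\ size q = x, path leq 0 q & last 0 q <= size q].
  rewrite mem_nondec_seqs // => /andP[/eqP wN wS].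
  have sz : size (p ++ rcons w (size p)) = x by rewrite size_cat size_rcons wN; lia.
  by split; rewrite ?cat_path ?pS // last_cat last_rcons sz ltnW.
apply: allpairs_uniq_dep => [|w wN|]; first exact: nondec_seqs_uniq.
  by have [sz qS lq] := next w wN; apply: IHc => //; rewrite sz.
move=> _ _ /allpairsPdep[w [v [wN vE ->]]] /allpairsPdep[w' [v' [wN' vE' ->]]] /= vv.
have [sz qS lq] := next w wN; have [sz' qS' lq'] := next w' wN'.
subst v'.
have Ew : take x v = p ++ rcons w (size p).
  move: vE; rewrite mem_extensions //; last by rewrite sz.
  by case/and4P=> _; rewrite prefixE sz => /eqP.
have Ew' : take x v = p ++ rcons w' (size p).
  move: vE'; rewrite mem_extensions //; last by rewrite sz'.
  by case/and4P=> _; rewrite prefixE sz' => /eqP.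
suff -> : w = w' by [].
have /eqP : p ++ rcons w (size p) = p ++ rcons w' (size p) by rewrite -Ew -Ew'.
by rewrite eqseq_cat // eqxx /= => /eqP/rcons_inj[].
Qed.

(** The number of extensions of a list depends only on its length and last entry. After the first
    block these are [x] and [size p] whatever [w] is, so the counts multiply. *)
Lemma size_extensions p c :
    path ltn (size p) c -> path leq 0 p -> last 0 p <= size p ->
  let i := nth 0 (last 0 p :: size p :: c) in
  size (extensions p c) =
  \prod_(j < size c) 'C(i j.+2 - i j - 1, i j.+1 - i j).
Proof.
elim: c p => [|x c IHc] p /=; first by rewrite big_ord0.
move=> /andP[px xc] pS lp; rewrite size_allpairs_dep big_ord_recl /=.
set C := (X in _ * X).
have -> : [seq size (extensions (p ++ rcons w (size p)) c) |
    w <- nondec_seqs (x - size p).-1 (last 0 p) (size p)] =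
  [seq C | w <- nondec_seqs (x - size p).-1 (last 0 p) (size p)].
  apply/eq_in_map => w; rewrite mem_nondec_seqs // => /andP[/eqP wN wS].
  have sz : size (p ++ rcons w (size p)) = x by rewrite size_cat size_rcons wN; lia.
  by rewrite IHc ?sz ?cat_path ?pS // last_cat last_rcons // ltnW.
rewrite sumnE big_map big_const_seq iter_addn_0 count_predT size_nondec_seqs mulnC.
by congr ('C(_, _) * C); lia.
Qed.


Lemma pval_mono v : path leq 0 v -> {in [pred m | m <= size v] &, {homo pval v : m m' / m <= m'}}.
Proof.
move=> vS m m' /= mN m'N mm'.
exact: (@sorted_leq_nth _ _ leq_trans leqnn 0 (0 :: v) vS).
Qed.

(** Between consecutive chain elements p < m <= x, monotonicity gives g m <= g x = p < m. *)
Lemma pval_lt p c v : path ltn p c -> path leq 0 v -> size v = last p c ->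
   path (fun x y => pval v y == x) p c ->
  forall m, p < m <= size v -> pval v m < m.
Proof.
elim: c p => [|x c IHc] p /= => [_ _ ->|/andP[px xc] vS vN /andP[/eqP vx vc]] m.
  by lia.
have [xm|mx] := ltnP x m => pm; first by apply: (IHc x) => //; lia.
have xv : x <= size v by rewrite vN path_ltn_last.
have : pval v m <= pval v x by apply: pval_mono => //=; rewrite ?inE; lia.
by rewrite vx; lia.
Qed.

(* Indices are shifted: [nth 0 v m] is the value of g at m + 1. *)
Definition ideal_seq N (v : seq nat) :=
  [&& size v == N, sorted leq v & all (fun m => nth 0 v m <= m) (iota 0 N)].

(** Read from its last entry down, a list in which g sends every entry to its predecessor is an
    orbit of g. *)
Lemma sorted_traject (g : nat -> nat) N s : s != [::] -> last 0 s = N ->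
  sorted (fun x y => g y == x) s = (s == rev (traject g N (size s))).
Proof.
rewrite -[s == rev _](inj_eq (can_inj (@revK _))) revK -size_rev.
rewrite -(rev_sorted (frel g)) -[in last 0 s](revK s).
have -> : (s != [::]) = (rev s != [::]) by rewrite -!size_eq0 size_rev.
case: (rev s) => //= x s' _; rewrite rev_cons last_rcons => ->.
rewrite eqseq_cons eqxx /=; apply/idP/eqP => [/fpathE //|->].
exact: fpath_traject.
Qed.

Lemma pval_le v : (forall m, 0 < m <= size v -> pval v m < m) -> forall m, pval v m <= m.
Proof.
move=> vlt m; have [mN|mN] := leqP m (size v).
  by case: m mN => // m mN; apply: ltnW; apply: vlt.
by rewrite /pval nth_default.
Qed.

(** The head 0 of [chain t] is the length of the empty list being extended, hence [behead]. *)
Lemma mem_extensions_chain n k (t : k.-tuple 'I_n.+2) (v : seq nat) :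
  sorted ltn (chain t) ->
  (v \in extensions [::] (behead (chain t))) =
  [&& sorted leq v, size v == n.+1 & chain t == rev (traject (pval v) n.+1 k.+2)].
Proof.
move=> tS; rewrite mem_extensions //=.
have -> : path leq 0 v = sorted leq v by case: (v).
rewrite last_rcons.
have := @sorted_traject (pval v) n.+1 (chain t) isT.
by rewrite /= last_rcons size_rcons size_map size_tuple prefix0s => ->.
Qed.

(** The orbit of n+1 under g decreases strictly until it hits 0, and the condition on [k] says that
    this happens exactly at step k+1. The k terms in between, read backwards, are the entries of
    [t]. *)
Lemma ideal_seq_chain n k (v : seq nat) :
  (ideal_seq n.+1 v /\ (iter k.+1 (pval v) n.+1 = 0 /\
     forall m, iter m.+1 (pval v) n.+1 = 0 -> k <= m)) <->
  exists2 t : k.-tuple 'I_n.+2, sorted ltn (chain t) & v \in extensions [::] (behead (chain t)).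
Proof.
split=> [[/and3P[/eqP vN vS /allP vle] [gk0 gmin]]|[t tS]].
  have vlt m : 0 < m <= size v -> pval v m < m.
    rewrite vN; case: m => // m mN; rewrite ltnS; apply: vle.
    by rewrite mem_iota.
  (* The orbit stays below n+2, so [inord] leaves its terms unchanged. *)
  have gN i : iter i (pval v) n.+1 < n.+2.
    by elim: i => //= i IHi; apply: leq_ltn_trans IHi; apply: pval_le.
  have sz : size [seq inord i : 'I_n.+2 | i <- rev (traject (pval v) (pval v n.+1) k)] == k.
    by rewrite size_map size_rev size_traject.
  have tE : chain (Tuple sz) = rev (traject (pval v) n.+1 k.+2).
    rewrite trajectS trajectSr -iterSr gk0 /chain rev_cons rev_rcons /=.
    congr (0 :: rcons _ _); rewrite -map_comp -[RHS]map_id.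
    apply/eq_in_map => i /=; rewrite mem_rev => /trajectP[j _ ->].
    by rewrite -iterSr inordK.
  have tS : sorted ltn (chain (Tuple sz)).
    rewrite tE rev_sorted; apply/(sortedP n.+1) => i.
    rewrite size_traject => ik; rewrite !nth_traject //; last exact: ltnW.
    apply: vlt; rewrite vN; apply/andP; split; last exact: gN.
    rewrite lt0n; apply/eqP.
    by case: i ik => // i ik /gmin; lia.
  by exists (Tuple sz); rewrite // mem_extensions_chain // vS vN tE !eqxx.
rewrite mem_extensions_chain // => /and3P[vS /eqP vN /eqP tE].
have tP : path ltn 0 (behead (chain t)) by [].
have vlt m : 0 < m <= size v -> pval v m < m.
  apply: (pval_lt tP); first by case: (v) vS.
    by rewrite /= last_rcons.
  have := @sorted_traject (pval v) n.+1 (chain t) isT.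
  rewrite /= last_rcons size_rcons size_map size_tuple => -> //.
  by rewrite -tE.
have gE i : i <= k.+1 -> iter i (pval v) n.+1 = nth n.+1 (chain t) (k.+1 - i).
  move=> ik; rewrite tE nth_rev size_traject ?nth_traject; try lia.
  by congr iter; lia.
split.
  rewrite /ideal_seq vN vS eqxx; apply/allP => m; rewrite mem_iota add0n => /andP[_ mN].
  by rewrite -ltnS; apply: (vlt m.+1); rewrite vN.
split=> [|m]; first by rewrite gE // subnn.
case: leqP => // mk; rewrite gE; last by lia.
(* If the orbit vanished before step k+1, then 0 would occur in the chain after its head, where all
   entries are positive. *)
have /allP/(_ (nth n.+1 (chain t) (k.+1 - m.+1))) := order_path_min ltn_trans tP.
rewrite /chain /= subSS; case E: (k - m) => [|j]; first by lia.
move=> /= H H0; rewrite H0 in H; suff: 0 < 0 by []; apply: H.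
rewrite -H0 mem_nth // size_rcons size_map size_tuple; lia.
Qed.

Lemma chain_eq n k (v : seq nat) (t t' : k.-tuple 'I_n.+2) :
    sorted ltn (chain t) -> sorted ltn (chain t') ->
    v \in extensions [::] (behead (chain t)) ->
  v \in extensions [::] (behead (chain t')) -> t = t'.
Proof.
move=> tS tS'; rewrite !mem_extensions_chain //.
case/and3P=> _ _ /eqP tE /and3P[_ _ /eqP]; rewrite -tE => -[/eqP].
by rewrite eqseq_rcons eqxx andbT => /eqP/(inj_map val_inj)/val_inj.
Qed.

Definition class_seqs n k : seq (seq nat) :=
  [seq v | t : k.-tuple 'I_n.+2 <- [seq t <- enum {: k.-tuple 'I_n.+2} | sorted ltn (chain t)],
           v <- extensions [::] (behead (chain t))].

Lemma mem_class_seqs n k (v : seq nat) :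
  v \in class_seqs n k <->
  ideal_seq n.+1 v /\ (iter k.+1 (pval v) n.+1 = 0 /\
     forall m, iter m.+1 (pval v) n.+1 = 0 -> k <= m).
Proof.
rewrite ideal_seq_chain; split=> [/allpairsPdep[t [w [tS vt ->]]]|[t tS vt]].
  by move: tS; rewrite mem_filter => /andP[tS _]; exists t.
by apply/allpairsPdep; exists t, v; split=> //; rewrite mem_filter tS mem_enum.
Qed.

Lemma size_class_seqs n k : size (class_seqs n k) = class_count n k.
Proof.
rewrite size_allpairs_dep sumnE big_map big_filter big_enum_cond.
rewrite (eq_bigl (fun t => sorted ltn (chain t))) => [|t]; last by rewrite inE.
apply: eq_bigr => t tS; rewrite size_extensions //.
rewrite /= size_rcons size_map size_tuple big_ord_recl /=.
(* There is one factor per element of [behead (chain t)], k+1 in all; the first is C(_, 0) = 1,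
   since g vanishes up to i_1. *)
rewrite subnn bin0 mul1n; apply: eq_bigr => j _.
by rewrite /bump /= add1n.
Qed.

Lemma class_seqs_uniq n k : uniq (class_seqs n k).
Proof.
apply: allpairs_uniq_dep => [|t|].
- by rewrite filter_uniq ?enum_uniq.
- by rewrite mem_filter => /andP[tS _]; apply: extensions_uniq.
move=> _ _ /allpairsPdep[t [v [tS vt ->]]] /allpairsPdep[t' [v' [tS' vt' ->]]] /= vv.
subst v'; move: tS tS'; rewrite !mem_filter => /andP[tS _] /andP[tS' _].
by rewrite (chain_eq tS tS' vt vt').
Qed.

Import GRing.Theory Num.Theory.
Local Open Scope ring_scope.

(** * Matrix units and staircase subspaces in an arbitrary basis *)

Section InBasis.
Variables (F : fieldType) (N : nat).
Implicit Types (P x y : 'M[F]_N).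

(* Locked, so that mxE does not unfold the entries. *)
Definition in_basis P x : 'M[F]_N := locked (P *m x *m invmx P).
Definition munit P i j := invmx P *m delta_mx i j *m P.

Lemma in_basisE P x : in_basis P x = P *m x *m invmx P.
Proof. by rewrite /in_basis -lock. Qed.

Fact in_basis_is_linear P : linear (in_basis P).
Proof. by move=> a x y; rewrite !in_basisE mulmxDr mulmxDl -scalemxAr -scalemxAl. Qed.
HB.instance Definition _ P := GRing.isLinear.Build F _ _ _ (in_basis P) (in_basis_is_linear P).

Variables (P : 'M[F]_N) (uP : P \in unitmx).

Lemma in_basisM x y : in_basis P (x *m y) = in_basis P x *m in_basis P y.
Proof. by rewrite !in_basisE !mulmxA mulmxKV. Qed.

Lemma in_basis_lie x y : in_basis P (lie x y) = lie (in_basis P x) (in_basis P y).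
Proof. by rewrite /lie linearB /= !in_basisM. Qed.

Lemma in_basis_trace x : \tr (in_basis P x) = \tr x.
Proof. by rewrite in_basisE mxtrace_mulC mulmxA mulVmx // mul1mx. Qed.

Lemma in_basis_inj : injective (in_basis P).
Proof.
move=> x y /(congr1 (fun z => invmx P *m z *m P)).
by rewrite !in_basisE !mulmxA !mulVmx // !mul1mx -!mulmxA !mulVmx // !mulmx1.
Qed.

Lemma in_basis_munit i j : in_basis P (munit P i j) = delta_mx i j.
Proof. by rewrite in_basisE /munit !mulmxA mulmxV // mul1mx mulmxK. Qed.

Lemma munit_neq0 i j : munit P i j != 0.
Proof.
apply/eqP => /(congr1 (in_basis P)); rewrite in_basis_munit linear0 => /matrixP/(_ i j)/eqP.
by rewrite !mxE !eqxx oner_eq0.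
Qed.

Lemma munit_sum x : x = \sum_ij in_basis P x ij.1 ij.2 *: munit P ij.1 ij.2.
Proof.
apply: in_basis_inj; rewrite linear_sum [LHS]matrix_sum_delta pair_bigA.
by apply: eq_bigr => ij _; rewrite linearZ /= in_basis_munit.
Qed.

Lemma munit_sl i j : i != j -> munit P i j \in sl F N.
Proof.
move=> ij; rewrite mem_sl -in_basis_trace in_basis_munit; apply/eqP/big1 => k _.
by rewrite mxE; case: eqP => // ->; rewrite (negPf ij).
Qed.

Lemma memv_munit (U : {vspace 'M[F]_N}) x :
  (forall i j, in_basis P x i j != 0 -> munit P i j \in U) -> x \in U.
Proof.
move=> xU; rewrite [x]munit_sum; apply: memv_suml => ij _.
by have [->|/xU ?] := eqVneq (in_basis P x ij.1 ij.2) 0; [rewrite scale0r mem0v | rewrite memvZ].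
Qed.

(** Here [g j.+1] is the height of column [j] and also the number, counted from 1, of its lowest
    row; this double reading turns brackets into composition of functions. *)
Definition stair (g : nat -> nat) : {vspace 'M[F]_N} :=
  (\sum_(ij : 'I_N * 'I_N | (ij.1 < g ij.2.+1)%N) <[munit P ij.1 ij.2]>)%VS.

Lemma mem_stair g x :
  x \in stair g <-> forall i j : 'I_N, (g j.+1 <= i)%N -> in_basis P x i j = 0.
Proof.
split=> [/memv_sumP[y yL ->] i j gi|x0].
  rewrite linear_sum summxE big1 // => kl klg; have /vlineP[c ->] := yL kl klg.
  rewrite linearZ /= in_basis_munit !mxE; case: eqP => [ki|]; last by rewrite mulr0.
  case: eqP => [lj|]; last by rewrite mulr0.
  by move: klg; rewrite -ki -lj ltnNge gi.
apply: memv_munit => i j xij; have ij: (i < g j.+1)%N.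
  by rewrite ltnNge; apply: contraNN xij => /x0->.
by rewrite memvE; apply: (sumv_sup (i, j)).
Qed.

Lemma munit_stair g (i j : 'I_N) : (munit P i j \in stair g) = (i < g j.+1)%N.
Proof.
apply/idP/idP => [/mem_stair/(_ i j)|ij].
  rewrite in_basis_munit mxE !eqxx /= ltnNge => H; apply/negP => /H/eqP.
  by rewrite oner_eq0.
by rewrite memvE; apply: (sumv_sup (i, j)).
Qed.

End InBasis.

(** * Entries of brackets and iterated brackets *)

Section LieMatrixUnits.
Variables (F : fieldType) (N : nat).
Implicit Types (x y : 'M[F]_N).

Lemma lieE x y i j :
  lie x y i j = \sum_k (x i k * y k j - y i k * x k j).
Proof. by rewrite !mxE -sumrB. Qed.

Lemma lie_deltaE (a b : 'I_N) x i j :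
  lie (delta_mx a b) x i j = (i == a)%:R * x b j - (j == b)%:R * x i a.
Proof.
rewrite lieE sumrB; congr (_ - _).
  rewrite (bigD1 b) //= big1 ?addr0 => [|k kb]; first by rewrite mxE eqxx andbT.
  by rewrite mxE (negPf kb) andbF mul0r.
rewrite (bigD1 a) //= big1 ?addr0 => [|k ka]; first by rewrite mxE eqxx mulrC.
by rewrite mxE (negPf ka) mulr0.
Qed.

(** At the corner (i, j), the triangular shape of [x] and the support of [y] leave only terms with a
    diagonal entry of [x]. The support is preserved, so the computation can be iterated. *)
Lemma lie_upper_diag x y (i j : 'I_N) :
    (forall k l : 'I_N, (l < k)%N -> x k l = 0) ->
    (forall k l : 'I_N, (i < k)%N || (l < j)%N -> y k l = 0) ->
  (forall k l : 'I_N, (i < k)%N || (l < j)%N -> lie x y k l = 0) /\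
  lie x y i j = (x i i - x j j) * y i j.
Proof.
move=> xU yU; split=> [k l kl|].
  rewrite lieE big1 // => m _.
  have -> : x k m * y m l = 0.
    have [mk|km] := ltnP m k; first by rewrite xU ?mul0r.
    by rewrite [y m l]yU ?mulr0 //; lia.
  have [lm|ml] := ltnP l m; first by rewrite [x m l]xU ?mulr0 ?subr0.
  by rewrite [y k m]yU ?mul0r ?subr0 //; lia.
rewrite lieE sumrB mulrBl; congr (_ - _).
  rewrite (bigD1 i) //= big1 ?addr0 // => k ki.
  have [ik|ik] := ltnP k i; first by rewrite xU ?mul0r.
  have ki' : (i < k)%N by rewrite ltn_neqAle ik eq_sym andbT; apply: contraNneq ki => /val_inj->.
  by rewrite yU ?mulr0 // ki'.
rewrite (bigD1 j) //= big1 ?addr0 => [|k kj]; first by rewrite mulrC.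
have [jk|kj'] := ltnP j k; first by rewrite [x k j]xU ?mulr0.
have kj2 : (k < j)%N by rewrite ltn_neqAle kj' andbT; apply: contraNneq kj => /val_inj->.
by rewrite yU ?mul0r // kj2 orbT.
Qed.

Lemma iter_lie_upper_diag x (i j : 'I_N) m :
    (forall k l : 'I_N, (l < k)%N -> x k l = 0) ->
  iter m (lie x) (delta_mx i j) i j = (x i i - x j j) ^+ m.
Proof.
move=> xU; suff [_ ->] : (forall k l : 'I_N, (i < k)%N || (l < j)%N ->
    iter m (lie x) (delta_mx i j) k l = 0) /\
  iter m (lie x) (delta_mx i j) i j = (x i i - x j j) ^+ m by [].
elim: m => [|m [IH0 IH1]].
  split=> [k l kl|]; last by rewrite mxE !eqxx.
  rewrite mxE; case: eqP => [ki|]; case: eqP => [lj|] //; move: kl; rewrite ki lj; lia.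
by have [H0 H1] := lie_upper_diag xU IH0; rewrite iterS H1 IH1 exprS.
Qed.

(** Each bracket with [x] pushes the support one diagonal up and to the right; for m = 0 no entry
    satisfies the inequality. *)
Lemma iter_lie_strict_upper x y m :
    (forall k l : 'I_N, (l <= k)%N -> x k l = 0) ->
  forall k l : 'I_N, (l + N < k + m)%N -> iter m (lie x) y k l = 0.
Proof.
move=> xU; elim: m => [|m IHm] k l klm.
  by have := ltn_ord k; lia.
rewrite iterS lieE big1 // => j _.
have -> : x k j * iter m (lie x) y j l = 0.
  have [jk|kj] := leqP j k; first by rewrite xU ?mul0r.
  by rewrite IHm ?mulr0 //; lia.
have [lj|jl] := leqP l j; first by rewrite [x j l]xU ?mulr0 ?subr0.
by rewrite IHm ?mul0r ?subr0 //; lia.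
Qed.

End LieMatrixUnits.

(** * Ad-nilpotent ideals of the trace-zero upper triangular matrices *)

Section Ideals.
Variables (F : numFieldType) (n : nat).
Local Notation N := n.+1.
Variables (P : 'M[F]_N) (uP : P \in unitmx) (b : {vspace 'M[F]_N}).
Hypothesis bP : forall x, x \in b <->
  \tr x = 0 /\ forall i j : 'I_N, (j < i)%N -> in_basis P x i j = 0.
Implicit Types (I : {vspace 'M[F]_N}) (x y : 'M[F]_N).

Lemma in_basis_iter_lie x y m :
  in_basis P (iter m (lie x) y) = iter m (lie (in_basis P x)) (in_basis P y).
Proof. by elim: m => //= m IHm; rewrite in_basis_lie // IHm. Qed.

(** Iterating [ad x] on E_ki multiplies its (k, i) entry by x_kk - x_ii, so nilpotence makes the
    diagonal constant; trace zero then makes it vanish. *)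
Lemma ad_nilpotent_strict_upper x : x \in b -> ad_nilpotent x ->
  forall i j : 'I_N, (j <= i)%N -> in_basis P x i j = 0.
Proof.
move=> /bP[trx xU] [m xm] i j; rewrite leq_eqVlt => /predU1P[/val_inj ->|]; last exact: xU.
have diag_eq k : in_basis P x k k = in_basis P x i i.
  have [->//|ki] := eqVneq k i; apply/eqP; rewrite -subr_eq0.
  have := xm (munit P k i) (munit_sl uP ki).
  move=> /(congr1 (in_basis P)); rewrite in_basis_iter_lie in_basis_munit // linear0.
  move=> /matrixP/(_ k i); rewrite iter_lie_upper_diag // mxE => /eqP.
  by rewrite expf_eq0 => /andP[].
move/eqP: trx; rewrite -(in_basis_trace uP) /mxtrace (eq_bigr _ (fun k _ => diag_eq k)).
by rewrite sumr_const card_ord mulrn_eq0 => /eqP.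
Qed.

(** E_ii with its trace part removed: the diagonal element on which the root e_k - e_l takes the
    value [k = i] - [l = i]. *)
Definition cocharacter (i : 'I_N) : 'M[F]_N := munit P i i - (N%:R^-1)%:M.

Lemma in_basis_scalar a : in_basis P a%:M = a%:M.
Proof. by rewrite in_basisE scalar_mxC -mulmxA mulmxV // mulmx1. Qed.

Lemma in_basis_cocharacter i : in_basis P (cocharacter i) = delta_mx i i - (N%:R^-1)%:M.
Proof. by rewrite linearB /= in_basis_munit // in_basis_scalar. Qed.

Lemma cocharacter_trace i : \tr (cocharacter i) = 0.
Proof.
rewrite -(in_basis_trace uP) in_basis_cocharacter linearB /= mxtrace_scalar.
rewrite -(mulr_natr N%:R^-1) mulVf ?pnatr_eq0 // /mxtrace (bigD1 i) //= mxE !eqxx.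
rewrite big1 ?addr0 ?subrr // => k ki.
by rewrite mxE (negPf ki).
Qed.

Lemma cocharacter_borel i : cocharacter i \in b.
Proof.
apply/bP; split=> [|k l lk]; first exact: cocharacter_trace.
rewrite in_basis_cocharacter !mxE -val_eqE -[l == i]val_eqE -[k == l]val_eqE.
have -> : (val k == val l) = false by apply/eqP => /= E; move: lk; rewrite E ltnn.
case: eqP => [ki|]; last by rewrite subr0.
case: eqP => [li|]; last by rewrite subr0.
by move: lk; rewrite ki li ltnn.
Qed.

Lemma lieBl x y z : lie (x - y) z = lie x z - lie y z.
Proof. by rewrite /lie mulmxBl mulmxBr !opprB [LHS]addrACA [RHS]addrACA [X in _ + X]addrC. Qed.

Lemma lie_scalarl a x : lie a%:M x = 0.
Proof. by rewrite /lie scalar_mxC subrr. Qed.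

Lemma in_basis_lie_cocharacter i x k l :
  in_basis P (lie (cocharacter i) x) k l = ((k == i)%:R - (l == i)%:R) * in_basis P x k l.
Proof.
rewrite in_basis_lie // in_basis_cocharacter lieBl lie_scalarl subr0 lie_deltaE mulrBl.
by congr (_ - _); case: eqP => [->|_]; rewrite ?mul0r.
Qed.

(** The cocharacters lie in [b] and act on each entry by a scalar, so brackets with them isolate a
    single entry of [x] inside [I]. *)
Lemma munit_ideal I x (i j : 'I_N) : ad_nilpotent_ideal b I -> x \in I ->
  in_basis P x i j != 0 -> munit P i j \in I.
Proof.
case=> Ib Ilie Inil xI xij.
have xU := ad_nilpotent_strict_upper (subvP Ib _ xI) (Inil _ xI).
have ij : i != j by apply: contraNneq xij => ->; rewrite xU.
(* On strictly upper triangular matrices, D i ^ 2 + D i is twice the projection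
   on row i; on that row, D j is minus the projection on the entry (i, j). *)
pose D k y := lie (cocharacter k) y.
have DI k y : y \in I -> D k y \in I by move=> yI; apply: Ilie; rewrite ?cocharacter_borel.
pose z := D i (D i x) + D i x.
have zI : z \in I by rewrite memvD ?DI.
suff E : D j z = (- (2 * in_basis P x i j)) *: munit P i j.
  have : D j z \in I by apply: DI.
  by rewrite E rpredZeq oppr_eq0 mulf_eq0 pnatr_eq0 (negPf xij).
apply: (in_basis_inj uP); rewrite linearZ /= in_basis_munit //; apply/matrixP => k l.
rewrite in_basis_lie_cocharacter linearD [X in _ * X = _]mxE !in_basis_lie_cocharacter !mxE.
have [->|ki] := eqVneq k i; have [->|lj] := eqVneq l j; rewrite ?eqxx /= ?(negPf ij) //.
all: rewrite ?[j == i]eq_sym ?(negPf ij) /=.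
all: try case: (k == j); try case: (l == i); rewrite /=; ring.
Qed.

Lemma lie_munit i j k : i != k -> lie (munit P i j) (munit P j k) = munit P i k.
Proof.
move=> ik; apply: (in_basis_inj uP); rewrite in_basis_lie // !in_basis_munit //.
rewrite /lie mul_delta_mx mul_delta_mx_cond.
by rewrite eq_sym (negPf ik) subr0.
Qed.

Lemma munit_borel (i j : 'I_N) : (i < j)%N -> munit P i j \in b.
Proof.
move=> ij; apply/bP; split.
  by apply/eqP; rewrite -mem_sl munit_sl //; apply: contraTneq ij => ->; rewrite ltnn.
move=> k l lk; rewrite in_basis_munit // mxE; case: eqP => // ki; case: eqP => // lj.
by move: lk; rewrite ki lj; lia.
Qed.

(** E_kl arises from E_ij by bracketing with E_ki and then E_jl, both in [b]; since i < j by
    nilpotence, each bracket is a single matrix unit up to sign. *)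
Lemma munit_ideal_le I (i j k l : 'I_N) : ad_nilpotent_ideal b I -> 
  munit P i j \in I -> (k <= i)%N -> (j <= l)%N -> munit P k l \in I.
Proof.
move=> II ijI ki jl; case: (II) => Ib Ilie Inil.
have ij : (i < j)%N.
  rewrite ltnNge; apply/negP => ji.
  have := ad_nilpotent_strict_upper (subvP Ib _ ijI) (Inil _ ijI) ji.
  by rewrite in_basis_munit // mxE !eqxx => /eqP; rewrite oner_eq0.
have neq (a c : 'I_N) : (a < c)%N -> a != c by move=> ac; apply: contraTneq ac => ->; rewrite ltnn.
have kjI : munit P k j \in I.
  move: ki; rewrite leq_eqVlt => /predU1P[/val_inj->//|ki].
  rewrite -(@lie_munit k i j); last by apply: neq; lia.
  by apply: Ilie => //; apply: munit_borel.
move: jl; rewrite leq_eqVlt => /predU1P[/val_inj<-//|jl].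
rewrite -(@lie_munit k j l); last by apply: neq; lia.
by rewrite lieNC memvN; apply: Ilie => //; apply: munit_borel.
Qed.

(** The list of column heights: by [munit_ideal_le] the rows i with E_ij in [I] form an initial
    segment, so the first missing row describes column j. *)
Definition ideal_code I : seq nat :=
  [seq find (fun i => munit P i j \notin I) (enum 'I_N) | j <- enum 'I_N].

Lemma nth_ideal_code I (i j : 'I_N) : ad_nilpotent_ideal b I -> 
  (i < nth 0 (ideal_code I) j)%N = (munit P i j \in I).
Proof.
move=> II; rewrite (nth_map j) ?size_enum_ord // nth_ord_enum.
set a := (fun i => _); set s := enum _.
have [ia|ai] := ltnP i (find a s).
  have := before_find i ia; rewrite nth_ord_enum => /negbFE -> //.
have hs : has a s by rewrite has_find; apply: leq_ltn_trans ai _; rewrite size_enum_ord.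
have := nth_find i hs; rewrite /a => aF.
apply/esym/negP => ijI; move/negP: aF; apply.
apply: (munit_ideal_le II ijI) => //.
by rewrite nth_enum_ord //; apply: leq_ltn_trans ai _.
Qed.

(** Strict upper triangularity keeps heights above the diagonal, and [I] is stable under moving a
    matrix unit to the right, so heights never decrease. *)
Lemma ideal_code_seq I : ad_nilpotent_ideal b I -> ideal_seq N (ideal_code I).
Proof.
move=> II; have codeP := nth_ideal_code _ _ II; case: (II) => Ib Ilie Inil.
have bound (j : 'I_N) : (nth 0 (ideal_code I) j <= j)%N.
  rewrite leqNgt codeP; apply/negP => jI.
  have := ad_nilpotent_strict_upper (subvP Ib _ jI) (Inil _ jI) (leqnn j).
  by rewrite in_basis_munit // mxE !eqxx => /eqP; rewrite oner_eq0.
have sz : size (ideal_code I) = N by rewrite size_map size_enum_ord.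
apply/and3P; split; first by rewrite sz.
  apply/(sortedP 0) => j; rewrite sz => jN.
  pose j0 : 'I_N := Ordinal (ltnW jN); pose j1 : 'I_N := Ordinal jN.
  rewrite leqNgt; apply/negP => lt_j.
  have iN : (nth 0 (ideal_code I) j.+1 < N)%N.
    by have := bound j1; rewrite /=; lia.
  pose i : 'I_N := Ordinal iN.
  have i0I : munit P i j0 \in I by rewrite -codeP.
  have : munit P i j1 \in I by apply: (munit_ideal_le II i0I (leqnn i)); apply: leqnSn.
  by rewrite -codeP ltnn.
apply/allP => j; rewrite mem_iota => /andP[_ jN]; exact: (bound (Ordinal jN)).
Qed.

Lemma ideal_stair I : ad_nilpotent_ideal b I -> I = stair P (pval (ideal_code I)).
Proof.
move=> II; apply/vspaceP => x; apply/idP/idP => [xI|].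
  apply/(mem_stair uP) => i j ij; apply/eqP; apply: contraTT ij => xij.
  by rewrite -ltnNge /pval /= nth_ideal_code // (munit_ideal II xI).
move=> /(mem_stair uP) x0; apply: (memv_munit uP) => i j xij.
rewrite -nth_ideal_code // ltnNge; apply: contraNN xij => ij.
by rewrite x0.
Qed.

Lemma stair_ideal v : ideal_seq N v -> ad_nilpotent_ideal b (stair P (pval v)).
Proof.
case/and3P=> /eqP vN vS /allP vle.
have vb (j : 'I_N) : (nth 0 v j <= j)%N by apply: vle; rewrite mem_iota /=.
have vm (k j : 'I_N) : (k <= j)%N -> (nth 0 v k <= nth 0 v j)%N.
  by apply: (sorted_leq_nth leq_trans leqnn 0 vS); rewrite inE vN.
have strict x : x \in stair P (pval v) -> forall i j : 'I_N, (j <= i)%N -> in_basis P x i j = 0.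
  by move=> /(mem_stair uP) x0 i j ji; apply: x0; apply: leq_trans ji; apply: vb.
split.
- apply/subvP => x xv; apply/bP; split=> [|i j ji]; last by rewrite (strict x) // ltnW.
  by rewrite -(in_basis_trace uP) /mxtrace big1 // => i _; rewrite (strict x).
- move=> x y /bP[_ xU] /(mem_stair uP) /= y0; apply/(mem_stair uP) => i j /= ij.
  rewrite in_basis_lie // lieE big1 // => k _.
  have -> : in_basis P x i k * in_basis P y k j = 0.
    have [ki|ik] := ltnP k i; first by rewrite xU ?mul0r.
    by rewrite y0 ?mulr0 //; apply: leq_trans ik.
  have [jk|kj] := ltnP j k; first by rewrite [in_basis P x k j]xU ?mulr0 ?subr0.
  by rewrite y0 ?mul0r ?subr0 //; apply: leq_trans ij; apply: vm.
(* 2N + 1 exceeds j + N for every column j, so the bound of [iter_lie_strict_upper] covers all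
   entries. *)
- move=> x xv; exists N.*2.+1 => y _; apply: (in_basis_inj uP).
  rewrite in_basis_iter_lie linear0; apply/matrixP => i j; rewrite [RHS]mxE.
  apply: iter_lie_strict_upper; first exact: strict.
  by have := ltn_ord j; lia.
Qed.

(** * Powers of a staircase ideal *)

Section Powers.
Variable g : nat -> nat.
Hypothesis g_le : forall m, (g m <= m.-1)%N.
Hypothesis g_mono : {in [pred m | m <= N] &, {homo g : m m' / m <= m'}}%N.

Lemma iter_stair_le m k : (iter m g k <= k)%N.
Proof.
elim: m => //= m; apply: leq_trans.
by apply: leq_trans (g_le _) (leq_pred _).
Qed.

Lemma iter_stair_mono m :
  {in [pred m | m <= N] &, {homo iter m g : i j / i <= j}}%N.
Proof.
elim: m => [|m IHm] i j iN jN ij //=.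
apply: g_mono; last exact: IHm.
- by rewrite inE; apply: leq_trans (iter_stair_le _ _) iN.
- by rewrite inE; apply: leq_trans (iter_stair_le _ _) jN.
Qed.

(** A product E_ik E_kj with i < g^(m+1) (k+1) and k+1 <= g (j+1) has i < g^(m+2) (j+1) by
    monotonicity; the opposite order of factors obeys the same bound. *)
Lemma lie_powS_stair m : lie_powS (stair P g) m = stair P (iter m.+1 g).
Proof.
elim: m => // m IHm; rewrite [LHS]/= -/(lie_powS _ m) IHm.
have gN (j : 'I_N) : (g j.+1 < N)%N.
  by have := g_le j.+1; have := ltn_ord j; rewrite /=; lia.
apply/eqP; rewrite eqEsubv; apply/andP; split.
  apply/span_subvP => _ /allpairsP[[x y] [/= xb yb ->]].
  have /(mem_stair uP) x0 := vbasis_mem xb.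
  have /(mem_stair uP) y0 := vbasis_mem yb.
  apply/(mem_stair uP) => i j ij; rewrite in_basis_lie // lieE big1 // => k _.
  have -> : in_basis P x i k * in_basis P y k j = 0.
    have [gk|kg] := leqP (g j.+1) k; first by rewrite y0 ?mulr0.
    rewrite x0 ?mul0r //; apply: leq_trans ij; rewrite [leqRHS]iterSr.
    by apply: iter_stair_mono; rewrite ?inE // ltnW.
  have [gk|kg] := leqP (iter m.+1 g j.+1) k; first by rewrite [in_basis P x k j]x0 ?mulr0 ?subr0.
  rewrite y0 ?mul0r ?subr0 //; apply: leq_trans ij; rewrite [leqRHS]iterS.
  apply: g_mono => //; rewrite inE //.
  by apply: leq_trans (iter_stair_le _ _) _.
apply/subvP => x /(mem_stair uP) x0; apply: (memv_munit uP) => i j xij.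
have : (i < iter m.+2 g j.+1)%N by rewrite ltnNge; apply: contraNN xij => /x0->.
rewrite iterSr => ig; have ij : i != j.
  apply: contraTneq ig => ->; rewrite -leqNgt.
  exact: leq_trans (iter_stair_le _ _) (g_le _).
have gj : (0 < g j.+1)%N.
  rewrite lt0n; apply: contraTneq ig => ->.
  by rewrite -leqNgt; apply: leq_trans (iter_stair_le _ _) _.
(* The lowest row of column j serves as the middle index k, so that k+1 = g (j+1). *)
have kN : ((g j.+1).-1 < N)%N by rewrite prednK // ltnW.
rewrite -(@lie_munit i (Ordinal kN) j) //; apply: memv_liev.
  by rewrite munit_stair //= prednK.
by rewrite munit_stair //= prednK.
Qed.

(** The last column is the highest, so a nonzero staircase contains the unit in the top right
    corner. *)
Lemma stair_eq0 : (stair P g = 0%VS) <-> g N = 0.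
Proof.
split=> [/vspaceP V0|gN].
  apply/eqP; rewrite -leqn0 leqNgt; apply/negP => gN.
  have := V0 (munit P ord0 ord_max); rewrite (munit_stair uP) gN memv0.
  by rewrite (negPf (munit_neq0 uP _ _)).
apply/vspaceP => x; rewrite memv0; apply/idP/eqP => [|->]; last exact: mem0v.
move=> /(mem_stair uP) x0; apply: (in_basis_inj uP); rewrite linear0; apply/matrixP => i j.
rewrite x0 ?mxE //; suff : (g j.+1 <= g N)%N by rewrite gN; lia.
by apply: g_mono; rewrite ?inE.
Qed.
End Powers.

End Ideals.

(** * Cartan subalgebras, roots and Borel subalgebras *)

Section Diagonalization.
Variables (F : numClosedFieldType) (n : nat).
Local Notation N := n.+1.

(** Multiplying one eigenvector v of [H] by trace-zero and scalar matrices yields every row vector,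
    and all these products lie in the sum of the eigenspaces of [H]. *)
Lemma ad_diagonalizable_mx (H : 'M[F]_N) : ad_diagonalizable H -> diagonalizable H.
Proof.
case=> e [/andP[/eqP eS _] eH].
have [a] := eigenvalue_closed H (ltn0Sn n).
case/eigenvalueP=> v vH v0.
(* Products of v with eigenvectors of ad H are eigenvectors of H. *)
have mul_eig y c : lie H y = c *: y -> (v *m y <= eigenspace H (a - c))%MS.
  move=> yc; apply/eigenspaceP; rewrite -mulmxA.
  have -> : y *m H = H *m y - c *: y by rewrite -yc /lie opprB addrC subrK.
  by rewrite mulmxBr mulmxA vH -scalemxAl -scalemxAr -scalerBl.
apply/diagonalizablePeigen.
(* [xget] picks an eigenvalue of [ad H] at [y]; one exists for each [y] in [e]. *)
pose ev y := a - xget 0 [set c : F | lie H y = c *: y]%classic.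
exists (undup (a :: [seq ev y | y <- e])); first exact: undup_uniq.
set S := (\sum_(r <- _) _)%MS.
have eigS r : r \in a :: [seq ev y | y <- e] -> (eigenspace H r <= S)%MS.
  rewrite -mem_undup /S => rs; rewrite (big_rem r) //=; exact: addsmxSl.
have slS y : y \in sl F N -> (v *m y <= S)%MS.
  rewrite -eS => /(@coord_span _ _ _ (in_tuple e)) ->; rewrite mulmx_sumr.
  apply: summx_sub => i _; rewrite -scalemxAr scalemx_sub //.
  have ye : e`_i \in e by rewrite mem_nth.
  apply: submx_trans (eigS (ev e`_i) _); last by rewrite in_cons map_f ?orbT.
  by apply: mul_eig; apply: (@xgetPex _ 0 [set c : F | lie H e`_i = c *: e`_i]%classic); apply: eH.
have vS : (v <= S)%MS.
  by apply: submx_trans (eigS a _); [apply/eigenspaceP | rewrite mem_head].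
have [k vk] : exists k, v 0 k != 0.
  apply/existsP; apply: contraNT v0 => /existsPn v0; apply/eqP/rowP => k.
  by rewrite mxE; apply/eqP; rewrite -[_ == _]negbK.
apply/eqmxP; rewrite submx1 /=; apply/row_subP => i.
move: (row i _) => w.
(* A matrix supported on row [k] that sends v to w; below it is split into its trace-zero and scalar
   parts. *)
pose z := \matrix_(j, l) ((j == k)%:R / v 0 k * w 0 l).
have -> : w = v *m z.
  apply/rowP => l; rewrite [RHS]mxE (bigD1 k) //= big1 => [|j jk].
    by rewrite !mxE eqxx addr0 mul1r mulrA mulfV // mul1r.
  by rewrite mxE (negPf jk) !mul0r mulr0.
rewrite -[z](subrK (\tr z / N%:R)%:M) mulmxDr addmx_sub //.
  apply: slS; rewrite mem_sl linearB /= mxtrace_scalar -[X in _ - X]mulr_natr mulfVK ?subrr //.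
  by rewrite pnatr_eq0.
by rewrite mul_mx_scalar scalemx_sub.
Qed.

Variables (h : {vspace 'M[F]_N}) (hh : cartan_subalgebra h).

(** Simultaneous diagonalisation is applied to a basis of [h] and extended by linearity. *)
Lemma cartan_codiagonalizable :
  exists2 P, P \in unitmx & {in h, forall x, forall i j, i != j -> in_basis P x i j = 0}.
Proof.
have [_ hcomm _ had] := hh.
have /codiagonalizableP[P uP /allP PD] :
    {in tval (vbasis h) &, forall A B, comm_mx A B} /\
    {in tval (vbasis h), forall A, diagonalizable A}.
  split=> [A B /vbasis_mem Ah /vbasis_mem Bh|A /vbasis_mem Ah].
    by apply/eqP; rewrite -subr_eq0; apply/eqP; apply: hcomm.
  by apply: ad_diagonalizable_mx; apply: had.
exists P => // x /coord_vbasis -> i j ij.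
rewrite linear_sum summxE big1 // => k _; rewrite linearZ /= mxE.
have /PD/(diagonalizable_forP _ uP)/(_ i j ij) : (vbasis h)`_k \in tval (vbasis h).
  by rewrite mem_nth // size_tuple.
by rewrite -in_basisE => ->; rewrite mulr0.
Qed.


End Diagonalization.

(** * Roots as differences of diagonal entries, and the Borel subalgebra *)

Section Roots.
Variables (F : numFieldType) (n : nat).
Local Notation N := n.+1.
Variables (h : {vspace 'M[F]_N}) (hh : cartan_subalgebra h).

Section Basis.
Variables (P : 'M[F]_N) (uP : P \in unitmx).
Hypothesis hP : {in h, forall x, forall i j, i != j -> in_basis P x i j = 0}.

Lemma lie_diagE (x y : 'M[F]_N) i j : (forall i j, i != j -> x i j = 0) ->
  lie x y i j = (x i i - x j j) * y i j.
Proof.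
move=> xD; rewrite lieE sumrB mulrBl; congr (_ - _).
  by rewrite (bigD1 i) //= big1 ?addr0 // => k ki; rewrite xD ?mul0r // eq_sym.
by rewrite (bigD1 j) //= big1 ?addr0 // => [|k ki]; [rewrite mulrC | rewrite xD ?mulr0].
Qed.

(** Trace-zero diagonal matrices commute with [h], which is maximal abelian. *)
Lemma mem_cartan x :
  x \in h <-> \tr x = 0 /\ forall i j, i != j -> in_basis P x i j = 0.
Proof.
have [hsl _ hmax _] := hh.
split=> [xh|[trx xD]].
  by split; [apply/eqP; rewrite -mem_sl (subvP hsl) | apply: hP].
apply: hmax => [|H Hh]; first by rewrite mem_sl trx.
apply: (in_basis_inj uP); rewrite in_basis_lie // linear0; apply/matrixP => i j.
rewrite lie_diagE ?mxE; last exact: hP.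
have [->|ij] := eqVneq i j; first by rewrite subrr mul0r.
by rewrite xD ?mulr0.
Qed.

Definition diag_root_fun i j (H : subvs_of h) : F^o :=
  in_basis P (vsval H) i i - in_basis P (vsval H) j j.

Fact diag_root_fun_is_linear i j : linear (diag_root_fun i j).
Proof.
move=> a x y; rewrite /diag_root_fun !linearP /= [LHS]/=.
rewrite ![(_ + _ : 'M__) _ _]mxE ![(a *: _ : 'M__) _ _]mxE.
by rewrite /GRing.scale /=; ring.
Qed.
HB.instance Definition _ i j :=
  GRing.isLinear.Build F (subvs_of h) F^o _ (diag_root_fun i j) (diag_root_fun_is_linear i j).

Definition diag_root i j : hdual h := linfun (diag_root_fun i j).

Lemma diag_rootE i j H : diag_root i j H = in_basis P (vsval H) i i - in_basis P (vsval H) j j.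
Proof. by rewrite lfunE. Qed.

Lemma cocharacter_cartan i : cocharacter P i \in h.
Proof.
apply/mem_cartan; split=> [|k l kl]; first exact: cocharacter_trace.
rewrite in_basis_cocharacter // !mxE (negPf kl) subr0.
by case: eqP => // ki; case: eqP => // li; move: kl; rewrite ki li eqxx.
Qed.

Lemma diag_root_cocharacter i j k :
  diag_root i j (Subvs (cocharacter_cartan k)) = (i == k)%:R - (j == k)%:R.
Proof.
rewrite diag_rootE /= in_basis_cocharacter // !mxE !eqxx !andbb /=.
by rewrite opprB addrA subrK.
Qed.

(** Evaluation at the cocharacters of i and j gives 1 and -1; as 2 is nonzero, this pins down k and
    l. *)
Lemma diag_root_inj i j k l : i != j -> diag_root k l = diag_root i j -> k = i /\ l = j.
Proof.
move=> ij E.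
have := diag_root_cocharacter k l i; rewrite E diag_root_cocharacter eqxx eq_sym (negPf ij).
have := diag_root_cocharacter k l j; rewrite E diag_root_cocharacter eqxx (negPf ij).
move=> Ej Ei; have neq01 : (1 : F) <> 0 by apply/eqP/oner_neq0.
have neq2 : (2 : F) <> 0 by apply/eqP; rewrite pnatr_eq0.
split; apply/eqP.
  case: (k == i) (l == i) Ei => [] [] //= Ei; [case: neq2|case: neq01].
    by move/eqP: Ei; rewrite subr0 sub0r -subr_eq0 opprK => /eqP.
  by move/eqP: Ei; rewrite subr0 subrr => /eqP.
case: (l == j) (k == j) Ej => [] [] //= Ej; [case: neq2|case: neq01].
  by move/eqP: Ej; rewrite subr0 sub0r eq_sym -subr_eq0 opprK => /eqP.
by move/eqP: Ej; rewrite subr0 sub0r oppr_eq0 => /eqP.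
Qed.

Lemma diag_rootii i : diag_root i i = 0.
Proof. by apply/lfunP => H; rewrite diag_rootE subrr lfunE. Qed.

Lemma diag_rootD i j k : diag_root i j + diag_root j k = diag_root i k.
Proof. by apply/lfunP => H; rewrite add_lfunE !diag_rootE addrA subrK. Qed.

Lemma diag_rootN i j : - diag_root i j = diag_root j i.
Proof. by apply/lfunP => H; rewrite opp_lfunE !diag_rootE opprB. Qed.

Lemma diag_root_neq0 i j : i != j -> diag_root i j != 0.
Proof.
move=> ij; apply/eqP => E.
have [] := @diag_root_inj i j i i ij; first by rewrite diag_rootii.
by move=> _ /eqP; rewrite (negPf ij).
Qed.

Lemma in_basis_root_space a x i j : x \in root_space a ->
  in_basis P x i j != 0 -> a = diag_root i j.
Proof.
case/root_spaceP=> _ xa xij; apply/lfunP => H'; apply: (mulIf xij).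
rewrite diag_rootE -lie_diagE; last exact/hP/subvsP.
by rewrite -in_basis_lie // xa linearZ mxE.
Qed.

Lemma munit_root_space i j : i != j -> munit P i j \in root_space (diag_root i j).
Proof.
move=> ij; apply/root_spaceP; split=> [|H]; first exact: munit_sl.
apply: (in_basis_inj uP); rewrite in_basis_lie // linearZ /= in_basis_munit //.
apply/matrixP => k l; rewrite lie_diagE; last exact/hP/subvsP.
rewrite diag_rootE !mxE; case: eqP => [->|]; last by rewrite !mulr0.
by case: eqP => [->|]; last by rewrite !mulr0.
Qed.

(** Any nonzero entry of a root vector determines its root, and that entry is off the diagonal
    because the root is nonzero. *)
Lemma is_rootP a : is_root a <-> exists i j, i != j /\ a = diag_root i j.
Proof.
split=> [[a0 ra]|[i [j [ij ->]]]]; last first.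
  split; first exact: diag_root_neq0.
  apply: contraTneq (munit_root_space ij) => ->.
  by rewrite memv0 (munit_neq0 uP).
pose x := vpick (root_space a).
have x0 : x != 0 by rewrite vpick0.
have [i [j xij]] : exists i j, in_basis P x i j != 0.
  apply: contraNP x0 => x0; apply/eqP/(in_basis_inj uP)/matrixP => i j.
  rewrite linear0 [RHS]mxE; apply/eqP; apply: contraPT x0 => xij.
  by move=> /(_ (ex_intro _ i (ex_intro _ j xij))).
have aE := in_basis_root_space (memv_pick _) xij; exists i, j; split=> //.
by apply: contraNneq a0 => ij; rewrite aE ij diag_rootii.
Qed.

Lemma is_root_diag_root i j : i != j -> is_root (diag_root i j).
Proof. by move=> ij; apply/is_rootP; exists i, j. Qed.

Section Positive.
Variables (Dp : seq (hdual h)) (hDp : positive_system Dp).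

Lemma positive_irr i : diag_root i i \notin Dp.
Proof. by apply/negP; case: hDp => H _ _ /H[]; rewrite diag_rootii eqxx. Qed.

Lemma positive_total i j : i != j -> (diag_root i j \in Dp) (+) (diag_root j i \in Dp).
Proof.
move=> ij; have [_ H _] := hDp; rewrite -[diag_root j i]diag_rootN.
exact/H/is_root_diag_root.
Qed.

(** Closure under sums applies once the sum is known to be a root: i = k would make a root and its
    opposite both positive. *)
Lemma positive_trans i j k :
  diag_root i j \in Dp -> diag_root j k \in Dp -> diag_root i k \in Dp.
Proof.
move=> ij jk; have [_ _ H] := hDp; rewrite -(diag_rootD i j k); apply: H => //.
rewrite diag_rootD; apply: is_root_diag_root; apply: contraTneq jk => <-.
have ij' : i != j by apply: contraTneq ij => ->; apply: positive_irr.
by have := positive_total ij'; rewrite ij.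
Qed.

(** Positivity of [diag_root i j] is a strict total order on indices; the permutation lists them in
    sorted order. *)
Lemma positive_sort : exists s : 'S_N, forall i j,
  (diag_root (s i) (s j) \in Dp) = (i < j)%N.
Proof.
pose le i j := (i == j) || (diag_root i j \in Dp).
have le_total : total le.
  move=> i j; rewrite /le; have [//|ij] := eqVneq i j.
  by have := positive_total ij; case: (_ \in Dp); case: (_ \in Dp); rewrite ?orbT.
have le_trans : transitive le.
  move=> j i k /predU1P[->//|ij] /predU1P[<-|jk]; first by rewrite /le ij orbT.
  by rewrite /le (positive_trans ij jk) orbT.
pose r := sort le (enum 'I_N).
have sr : size r = N by rewrite size_sort size_enum_ord.
have ur : uniq r by rewrite sort_uniq enum_uniq.
have f_inj : injective (fun i : 'I_N => nth ord0 r i).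
  by move=> i j /eqP; rewrite nth_uniq ?sr // => /eqP/val_inj.
exists (perm f_inj) => i j; rewrite !permE.
have lt_mem (k l : 'I_N) : (k < l)%N -> diag_root (nth ord0 r k) (nth ord0 r l) \in Dp.
  move=> kl; have : le (nth ord0 r k) (nth ord0 r l).
    apply: (sorted_ltn_nth le_trans ord0 (sort_sorted le_total _)) => //;
      by rewrite inE -/r sr.
  by case/predU1P => // /f_inj kl'; move: kl; rewrite kl' ltnn.
have [ij|ji] := ltnP i j; first exact: lt_mem.
move: ji; rewrite leq_eqVlt => /predU1P[/val_inj ->|ji]; first exact/negbTE/positive_irr.
apply/negbTE; have := lt_mem _ _ ji.
have ij' : nth ord0 r i != nth ord0 r j.
  by rewrite nth_uniq ?sr //; apply: contraTneq ji => ->; rewrite ltnn.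
by have := positive_total ij'; case: (_ \in Dp) => /=; case: (_ \in Dp).
Qed.

(** Achieved later by permuting the rows of [P] as in [positive_sort]. *)
Hypothesis Dp_ltn : forall i j, (diag_root i j \in Dp) = (i < j)%N.

Lemma mem_borel x :
  x \in borel Dp <-> \tr x = 0 /\ forall i j : 'I_N, (j < i)%N -> in_basis P x i j = 0.
Proof.
split=> [/memv_addP[y yh [z zD ->]]|[trx xU]].
  have [try yD] := (mem_cartan y).1 yh.
  suff [trz zU] : \tr z = 0 /\ forall i j : 'I_N, (j < i)%N -> in_basis P z i j = 0.
    rewrite linearD /= try trz addr0; split=> // i j ij.
    rewrite linearD mxE zU // yD ?addr0 //.
    by apply: contraTneq ij => ->; rewrite ltnn.
  rewrite big_seq in zD; elim/big_rec: _ z zD => [|a U aD IHU] z.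
    by rewrite memv0 => /eqP ->; rewrite !linear0; split=> // i j _; rewrite mxE.
  case/memv_addP=> u ua [w /IHU[trw wU] ->].
  have /root_spaceP[usl _] := ua.
  split; first by rewrite linearD /= trw addr0; apply/eqP; rewrite -mem_sl.
  move=> i j ji; rewrite linearD mxE wU // addr0; apply: contraTeq ji => uij.
  by rewrite -leqNgt ltnW // -Dp_ltn -(in_basis_root_space ua uij).
(* The strictly upper part of [x], a sum of positive root vectors; [x - u] is diagonal of trace
   zero, hence in [h]. *)
pose u := \sum_(ij : 'I_N * 'I_N | (ij.1 < ij.2)%N) in_basis P x ij.1 ij.2 *: munit P ij.1 ij.2.
have uE (k l : 'I_N) : k != l -> in_basis P u k l = in_basis P x k l.
  move=> kl; rewrite linear_sum summxE /=.
  have E (ij : 'I_N * 'I_N) : (in_basis P (in_basis P x ij.1 ij.2 *: munit P ij.1 ij.2)) k l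
      = in_basis P x ij.1 ij.2 * ((k == ij.1) && (l == ij.2))%:R.
    by rewrite linearZ /= in_basis_munit // !mxE.
  rewrite (eq_bigr _ (fun ij _ => E ij)).
  have [lt_kl|lk] := ltnP k l.
    rewrite (bigD1 (k, l)) //= !eqxx mulr1 big1 ?addr0 // => -[i j] /andP[_ ijkl].
    case: andP => [/= [/eqP ki /eqP lj]|]; last by rewrite mulr0.
    by rewrite ki lj eqxx in ijkl.
  have lt_lk : (l < k)%N by rewrite ltn_neqAle lk andbT eq_sym.
  rewrite xU // big1 // => -[i j] /= ij.
  case: andP => [[/eqP ki /eqP lj]|]; last by rewrite mulr0.
  by move: ij; rewrite -ki -lj ltnNge lk.
rewrite -[x](subrK u); apply: memv_add.
  apply/mem_cartan; split=> [|k l kl]; last by rewrite linearB !mxE uE ?subrr.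
  rewrite linearB /= trx sub0r; apply/eqP; rewrite oppr_eq0 -mem_sl.
  apply: memv_suml => ij lt_ij; rewrite memvZ // munit_sl //.
  by apply: contraTneq lt_ij => ->; rewrite ltnn.
apply: memv_suml => -[i j] /= ij; apply: memvZ.
have /munit_root_space : i != j by apply: contraTneq ij => ->; rewrite ltnn.
apply: subvP; rewrite -Dp_ltn in ij.
by rewrite (big_rem _ ij) /= addvSl.
Qed.
End Positive.
End Basis.
End Roots.


(** * Classification and count of the ideals *)

Lemma in_basis_row_perm (F : fieldType) N (P : 'M[F]_N) (s : 'S_N) x i j :
  P \in unitmx -> in_basis (row_perm s P) x i j = in_basis P x (s i) (s j).
Proof.
move=> uP.
have uPs : row_perm s P \in unitmx by rewrite row_permE unitmx_mul unitmx_perm.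
have -> : in_basis P x (s i) (s j) = (row_perm s (col_perm s (in_basis P x))) i j by rewrite !mxE.
have -> : in_basis (row_perm s P) x = row_perm s (col_perm s (in_basis P x)); last by [].
apply: (can_inj (mulmxK uPs)); rewrite in_basisE mulmxKV //.
rewrite !row_permE col_permE in_basisE !mulmxA -(mulmxA _ (perm_mx _) (perm_mx s)).
by rewrite -perm_mxM mulVg perm_mx1 mulmx1 mulmxKV.
Qed.

Lemma borel_standard_form (F : numClosedFieldType) n (h : {vspace 'M[F]_n.+1})
    (Dp : seq (hdual h)) : cartan_subalgebra h -> positive_system Dp ->
  exists2 P, P \in unitmx & forall x, x \in borel Dp <->
    \tr x = 0 /\ forall i j : 'I_n.+1, (j < i)%N -> in_basis P x i j = 0.
Proof.
move=> hh hDp; have [P uP hP] := cartan_codiagonalizable hh.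
have [s sP] := positive_sort hh uP hP hDp.
have uPs : row_perm s P \in unitmx by rewrite row_permE unitmx_mul unitmx_perm.
exists (row_perm s P) => //; apply: mem_borel => // [x xh i j ij|i j].
  by rewrite in_basis_row_perm // hP // (inj_eq perm_inj).
rewrite -sP; congr (_ \in Dp); apply/lfunP => H.
by rewrite !diag_rootE !in_basis_row_perm.
Qed.

Lemma pval_le_pred N v m : ideal_seq N v -> (pval v m <= m.-1)%N.
Proof.
case/and3P=> /eqP vN _ /allP vle; case: m => // m; rewrite /pval /=.
have [mN|Nm] := ltnP m N; first by apply: vle; rewrite mem_iota.
by rewrite nth_default ?vN.
Qed.

Section Classification.
Variables (F : numFieldType) (n : nat) (P : 'M[F]_n.+1) (b : {vspace 'M[F]_n.+1}).
Hypotheses (uP : P \in unitmx) (bP : forall x, x \in b <->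
  \tr x = 0 /\ forall i j : 'I_n.+1, (j < i)%N -> in_basis P x i j = 0).

Lemma stair_class v k : ideal_seq n.+1 v ->
  nilpotence_class (stair P (pval v)) k <->
  iter k.+1 (pval v) n.+1 = 0%N /\
    forall m, iter m.+1 (pval v) n.+1 = 0%N -> (k <= m)%N.
Proof.
move=> Iv; have g_le m := pval_le_pred m Iv.
have g_mono : {in [pred m | (m <= n.+1)%N] &, {homo pval v : m m' / (m <= m')%N}}.
  by case/and3P: Iv => /eqP vN vS _; rewrite -vN; apply: pval_mono; case: (v) vS.
have zeroE m : lie_powS (stair P (pval v)) m = 0%VS <-> iter m.+1 (pval v) n.+1 = 0%N.
  rewrite lie_powS_stair //; apply: stair_eq0 => //; exact: iter_stair_mono.
rewrite /nilpotence_class zeroE.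
by split=> -[? kmin]; split=> // m /zeroE /kmin.
Qed.

Lemma stair_pval_inj v v' : ideal_seq n.+1 v -> ideal_seq n.+1 v' ->
  stair P (pval v) = stair P (pval v') -> v = v'.
Proof.
move=> Iv Iv' /vspaceP E.
have lt_iff (i j : 'I_n.+1) : (i < nth 0 v j)%N = (i < nth 0 v' j)%N.
  by have := E (munit P i j); rewrite !munit_stair.
have [/eqP vN _ /allP vle] := and3P Iv; have [/eqP vN' _ /allP vle'] := and3P Iv'.
apply: (@eq_from_nth _ 0%N) => [|j]; rewrite vN ?vN' // => jN.
(* These bounds make the smaller of two different heights a valid row index, at which the two
   staircases differ. *)
have bv : (nth 0 v j <= j)%N by apply: vle; rewrite mem_iota.
have bv' : (nth 0 v' j <= j)%N by apply: vle'; rewrite mem_iota.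
have [lt_v|lt_v|//] := ltngtP (nth 0 v j)%N (nth 0 v' j)%N.
  have := lt_iff (Ordinal (leq_ltn_trans bv jN)) (Ordinal jN).
  by rewrite /= lt_v ltnn.
have := lt_iff (Ordinal (leq_ltn_trans bv' jN)) (Ordinal jN).
by rewrite /= lt_v ltnn.
Qed.

Lemma card_ideals_class k :
  ([set I : {vspace 'M[F]_n.+1} | ad_nilpotent_ideal b I /\ nilpotence_class I k]
   #= `I_(class_count n k))%classic%card.
Proof.
set A := (X in (X #= _)%card).
(* Numbering the ideals by positions in the duplicate-free list [class_seqs n k] makes their number
   its length. *)
pose f i := stair P (pval (nth [::] (class_seqs n k) i)).
have mem_seqs i : (i < class_count n k)%N -> nth [::] (class_seqs n k) i \in class_seqs n k.
  by move=> ik; rewrite mem_nth // size_class_seqs.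
have -> : A = (f @` `I_(class_count n k))%classic.
  apply/seteqP; split=> [I [II Ik]|_ [i /= ik <-]].
    have Iv := ideal_code_seq uP bP II.
    have IE := ideal_stair uP bP II.
    have vL : ideal_code P I \in class_seqs n k.
      by apply/mem_class_seqs; split=> //; apply/stair_class; rewrite -?IE.
    exists (index (ideal_code P I) (class_seqs n k)).
      by rewrite /= -size_class_seqs index_mem.
    by rewrite /f nth_index.
  have /mem_class_seqs[Iv vk] := mem_seqs _ ik.
  by split; [apply: stair_ideal | apply/stair_class].
apply: inj_card_eq => i j; rewrite !inE => ik jk.
have /mem_class_seqs[Ii _] := mem_seqs _ ik; have /mem_class_seqs[Ij _] := mem_seqs _ jk.
move=> /(stair_pval_inj Ii Ij) /eqP; rewrite nth_uniq ?size_class_seqs ?class_seqs_uniq //.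
by move/eqP.
Qed.
End Classification.

Theorem theorem4p2 (R : realType) (n k : nat) (hn : (1 <= n)%N) (hk : (k <= n)%N)
    (h : {vspace 'M[R[i]%C]_n.+1}) (hh : cartan_subalgebra h)
    (Dp : seq (hdual h)) (hDp : positive_system Dp) :
  ([set I : {vspace 'M[R[i]%C]_n.+1} |
      ad_nilpotent_ideal (borel Dp) I /\ nilpotence_class I k]
   #= `I_(class_count n k))%classic%card.
Proof.
have [P uP bP] := borel_standard_form hh hDp.
exact: card_ideals_class uP bP k.
Qed.
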